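(* Let $G=(V,E)$ be a strongly connected digraph, and let $w$ be a vector in $\operatorname{Sp}(V)$. Then $\mathbb{A}_G(w)$ is a nonempty convex set and its closure is $\widehat{\mathbb{A}}_G(w)$.
   Context: Digraphs are finite and simple: no self-loops and at most one edge for each ordered pair of vertices; $V=\{1,\ldots,n\}$. $G$ is strongly connected if for every ordered pair $(i,j)$ of vertices there is a (directed) path from $i$ to $j$ (a one-vertex graph is strongly connected). $\operatorname{Sp}(V)$ is the set of vectors in $\mathbb{R}^n$ with all entries positive and summing to one. An infinitesimal stochastic matrix (ISM) is a real square matrix with non-negative off-diagonal entries whose rows each sum to zero. $\mathbb{A}_G$ is the set of $n\times n$ ISMs $A=(a_{ij})$ with $a_{ij}=0$ whenever $i\neq j$ and $i\to j$ is not an edge of $G$; if $G$ has a single vertex, $\mathbb{A}_G=\{0\}$. $\mathbb{A}_G(w)$ is the set of $A\in\mathbb{A}_G$ having a simple zero eigenvalue and satisfying $A^\top w=0$. $\widehat{\mathbb{A}}_G(w)=\{A\in\mathbb{A}_G\mid A^\top w=0\}$. *)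

(* Defs.v *)
From mathcomp Require Import all_boot all_order all_algebra.
From mathcomp Require Import all_classical.
From mathcomp Require Import reals topology normedtype convex.
Set Implicit Arguments.
Unset Strict Implicit.
Unset Printing Implicit Defensive.
Import Order.TTheory GRing.Theory Num.Theory.
Import numFieldNormedType.Exports.
Local Open Scope classical_set_scope.
Local Open Scope ring_scope.

(* The vertex set {1, ..., n} is represented by 'I_n. A relation has at most
   one edge for each ordered pair, so only self-loops have to be excluded. *)
Record digraph (n : nat) := Digraph {
  edge :> rel 'I_n;
  edge_irreflexive : irreflexive edge }.

(* [connect] is reachability by a directed path, the empty path included. *)
Definition strongly_connected (n : nat) (G : digraph n) : Prop :=
  forall i j : 'I_n, connect G i j.

Definition Sp (R : realType) (n : nat) : set 'cV[R]_n :=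
  [set w | (forall i, 0 < w i ord0) /\ \sum_(i < n) w i ord0 = 1].
Arguments Sp : clear implicits.

Definition is_ISM (R : realType) (n : nat) (A : 'M[R]_n) : Prop :=
  (forall i j : 'I_n, i != j -> 0 <= A i j) /\
  (forall i : 'I_n, \sum_(j < n) A i j = 0).

(* For n = 1 the row-sum condition alone gives ISM_of G = [set 0], so the
   single-vertex convention needs no separate clause. *)
Definition ISM_of (R : realType) (n : nat) (G : digraph n) : set 'M[R]_n :=
  [set A | is_ISM A /\ (forall i j : 'I_n, i != j -> ~~ G i j -> A i j = 0)].

(* Simple means of algebraic multiplicity one. *)
Definition simple_eigenvalue (R : realType) (n : nat) (A : 'M[R]_n) (a : R)
    : Prop :=
  mup a (char_poly A) = 1%N.

Definition ISM_simple (R : realType) (n : nat) (G : digraph n) (w : 'cV[R]_n)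
    : set 'M[R]_n :=
  [set A | [/\ ISM_of G A, simple_eigenvalue A 0 & A^T *m w = 0]].

Definition ISM_hat (R : realType) (n : nat) (G : digraph n) (w : 'cV[R]_n)
    : set 'M[R]_n :=
  [set A | ISM_of G A /\ A^T *m w = 0].

(* Main.v *)
Require Import Defs.
From mathcomp Require Import all_boot all_order all_algebra.
From mathcomp Require Import all_classical.
From mathcomp Require Import reals topology normedtype convex.
From mathcomp Require Import ring.
Set Implicit Arguments.
Unset Strict Implicit.
Unset Printing Implicit Defensive.
Import Order.TTheory GRing.Theory Num.Theory.
Import numFieldNormedType.Exports.
Local Open Scope classical_set_scope.
Local Open Scope ring_scope.

(** For [A] in [ISM_hat G w] the quadratic form [x^T diag(w) A x] equals
    [-1/2 * \sum_(i, j) w_i a_ij (x_i - x_j)^2], because both the row sums and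
    the column sums of [diag(w) A] vanish. The sum is nonnegative and linear in
    [A], and the zero eigenvalue of [A] is simple exactly when it vanishes only
    on constant vectors. Hence adding a positive multiple of an element of
    [ISM_simple G w] to an element of the convex cone [ISM_hat G w] stays in
    [ISM_simple G w]; this gives convexity, and density along segments.
    An element of [ISM_simple G w] is obtained from the Laplacian of [G] by
    rescaling its rows by [p_i / w_i], where [p > 0] is a left null vector. *)

(** * Rank-one perturbations and the multiplicity of the eigenvalue zero *)

(* Sylvester's identity, multiplied by [c] so that [n = 0] and a non-invertible
   [c] need no special treatment. *)
Lemma det_scalar_add_rank1 (R : comNzRingType) (n : nat) (c : R)
    (u : 'cV[R]_n) (v : 'rV[R]_n) :
  \det (c%:M + u *m v) * c = (c + (v *m u) 0 0) * c ^+ n.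
Proof.
(* [B] is made triangular in two ways: by elimination from the left, which produces the wanted
   determinant, and by a right factor that avoids dividing by [c]. *)
pose B : 'M[R]_(1 + n) := block_mx 1%:M v (- u) c%:M.
have dB : \det B = \det (c%:M + u *m v).
  have -> : B = block_mx 1%:M 0 (- u) 1%:M *m block_mx 1%:M v 0 (c%:M + u *m v).
    rewrite mulmx_block !mul1mx !mul0mx mulmx1 !addr0 mulNmx.
    by rewrite addrCA addNr addr0.
  by rewrite det_mulmx det_lblock det_ublock !det1 !mul1r.
rewrite -{}dB.
have -> : \det B * c = \det (B *m block_mx c%:M 0 u 1%:M).
  by rewrite det_mulmx det_lblock det1 mulr1 det_scalar expr1.
rewrite mulmx_block !mul1mx !mulmx0 !mulmx1 !add0r mul_mx_scalar mul_scalar_mx.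
rewrite scalerN addNr det_ublock det_scalar det_mx11.
by rewrite !mxE eqxx mulr1n.
Qed.

(* Since [A u = 0] and [v u = 1], [(X - A)(X + u v) = X (X - (A - u v))]: the
   rank-one perturbation moves one zero eigenvalue of [A] to [-1]. *)
Lemma char_poly_sub_rank1 (F : fieldType) (n : nat) (A : 'M[F]_n)
    (u : 'cV[F]_n) (v : 'rV[F]_n) :
  A *m u = 0 -> v *m u = 1%:M ->
  char_poly A * ('X + 1) = 'X * char_poly (A - u *m v).
Proof.
move=> Au vu.
pose a := map_mx polyC A; pose u' := map_mx polyC u; pose v' := map_mx polyC v.
have au : a *m u' = 0 by rewrite /a /u' -map_mxM Au map_mx0.
have vu' : v' *m u' = 1%:M by rewrite /v' /u' -map_mxM vu map_scalar_mx.
have E : char_poly_mx A *m ('X%:M + u' *m v') =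
         'X *: char_poly_mx (A - u *m v).
  rewrite /char_poly_mx map_mxB map_mxM -/a -/u' -/v'.
  rewrite mulmxDr !mulmxBl (mulmxA a) au mul0mx subr0 !mul_scalar_mx mul_mx_scalar.
  rewrite !scalerBr opprB.
  by rewrite -addrA [- _ + _]addrC.
(* Here [c = 'X] and [v u = 1], so [\det ('X + u v) * 'X = ('X + 1) * 'X^n]; the power ['X^n] comes
   back from [detZ] and cancels. *)
have := det_scalar_add_rank1 'X u' v'; rewrite vu' mxE eqxx mulr1n => D.
have Xn0 : 'X^n != 0 :> {poly F} by rewrite expf_neq0 ?polyX_eq0.
apply: (mulIf Xn0); rewrite -mulrA -D mulrA /char_poly -det_mulmx E detZ.
ring.
Qed.

(** The multiplicity of zero is one more for [A] than for [A - u v], so simplicity means that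
    [A - u v] has no nonzero left null vector. Multiplying [y (A - u v) = 0] by [u] gives [y u = 0],
    hence [y A = 0]. *)
Lemma mup0_char_polyP (F : fieldType) (n : nat) (A : 'M[F]_n)
    (u : 'cV[F]_n) (v : 'rV[F]_n) :
  A *m u = 0 -> v *m A = 0 -> v *m u = 1%:M ->
  mup 0 (char_poly A) = 1%N <->
  (forall y : 'rV[F]_n, y *m A = 0 -> y *m u = 0 -> y = 0).
Proof.
move=> Au vA vu; have E := char_poly_sub_rank1 Au vu.
have cp0 (M : 'M[F]_n) : char_poly M != 0 by rewrite monic_neq0 ?char_poly_monic.
have -> : mup 0 (char_poly A) = (mup 0 (char_poly (A - u *m v))).+1.
  have <- : mup 0 (char_poly A * ('X + 1)) = mup 0 (char_poly A).
    by rewrite mupMl // rootE !hornerE oner_eq0.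
  rewrite E mupM ?polyX_eq0 //.
  by have := mup_XsubCX 1 (0 : F) 0; rewrite subr0 expr1 eqxx => ->.
have -> : (mup 0 (char_poly (A - u *m v))).+1 = 1%N <->
    ~~ eigenvalue (A - u *m v) 0.
  rewrite eigenvalue_root_char root_factor_theorem XsubC_dvd // lt0n negbK.
  by split=> [[->]|/eqP ->].
split=> [/eigenvalueP H y yA yu|H].
  apply/eqP/negP => /negP y0; apply: H; exists y => //.
  by rewrite mulmxBr mulmxA yA yu mul0mx subr0 scale0r.
apply/eigenvalueP => -[y]; rewrite scale0r mulmxBr mulmxA.
move=> yM /eqP; apply.
have yu : y *m u = 0.
  have := congr1 (mulmx^~ u) yM.
  rewrite /= mulmxBl -mulmxA Au mulmx0 -!mulmxA vu mulmx1 mul0mx sub0r.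
  by move/eqP; rewrite oppr_eq0 => /eqP.
by apply: H => //; move: yM; rewrite yu mul0mx subr0.
Qed.

(** Serves to spread zeros of a left null vector backwards along edges, and equality of values along
    paths. *)
Lemma connect_sub_rel (T : finType) (e : rel T) (S : T -> T -> Prop) :
  (forall x, S x x) -> (forall x y z, S x y -> S y z -> S x z) ->
  (forall x y, e x y -> S x y) -> forall x y, connect e x y -> S x y.
Proof.
move=> Sr St Se x y /connectP[p + ->]; elim: p x => [//|z p IH] x /= /andP[xz pz].
by apply: St (Se _ _ xz) (IH _ pz).
Qed.

(** * The Dirichlet form and its link with simplicity *)

Section Dirichlet.
Context (R : realType) (n : nat).
Implicit Types (A B : 'M[R]_n) (w : 'cV[R]_n) (x : 'I_n -> R).

(** For an ISM [A] with invariant weights [w], twice the Dirichlet form of the generator [A]. The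
    diagonal entries, which may be negative, are multiplied by zero. *)
Definition dirichlet w A x : R :=
  \sum_(i < n) \sum_(j < n) w i 0 * A i j * (x i - x j) ^+ 2.

Lemma trmx_mul_eq0P A w :
  A^T *m w = 0 <-> forall j, \sum_(i < n) w i 0 * A i j = 0.
Proof.
have E j : (A^T *m w) j 0 = \sum_(i < n) w i 0 * A i j.
  by rewrite mxE; apply: eq_bigr => i _; rewrite mxE mulrC.
split=> [H j|H]; first by rewrite -E H mxE.
by apply/colP => j; rewrite E H mxE.
Qed.

Lemma mulmx_const1_eq0P A :
  A *m const_mx 1 = 0 :> 'cV[R]_n <-> forall i, \sum_(j < n) A i j = 0.
Proof.
have E i : (A *m (const_mx 1 : 'cV_n)) i 0 = \sum_(j < n) A i j.
  by rewrite mxE; apply: eq_bigr => j _; rewrite mxE mulr1.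
split=> [H i|H]; first by rewrite -E H mxE.
by apply/colP => i; rewrite E H mxE.
Qed.

Lemma dirichlet_term_ge0 w A x : (forall i, 0 < w i 0) -> is_ISM A ->
  forall i j, 0 <= w i 0 * A i j * (x i - x j) ^+ 2.
Proof.
move=> w0 [A0 _] i j; have [->|ij] := eqVneq i j.
  by rewrite subrr expr0n mulr0.
by rewrite mulr_ge0 ?sqr_ge0 // mulr_ge0 ?A0 // ltW.
Qed.

Lemma dirichlet_ge0 w A x : (forall i, 0 < w i 0) -> is_ISM A ->
  0 <= dirichlet w A x.
Proof.
by move=> w0 IA; apply: sumr_ge0 => i _; apply: sumr_ge0 => j _;
   exact: dirichlet_term_ge0.
Qed.

Lemma dirichlet_eq0 w A x : (forall i, 0 < w i 0) -> is_ISM A ->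
  dirichlet w A x = 0 -> forall i j, A i j != 0 -> x i = x j.
Proof.
move=> w0 IA D i j Aij; have T_ge0 := dirichlet_term_ge0 x w0 IA.
have Di : \sum_(j < n) w i 0 * A i j * (x i - x j) ^+ 2 = 0.
  by apply: (psumr_eq0P _ D) => // k _; apply: sumr_ge0.
have /eqP : w i 0 * A i j * (x i - x j) ^+ 2 = 0.
  by apply: (psumr_eq0P _ Di).
by rewrite !mulf_eq0 orbb subr_eq0 (negPf Aij) gt_eqF //= => /eqP.
Qed.

Lemma dirichlet_linear w A B x (s t : R) :
  dirichlet w (s *: A + t *: B) x = s * dirichlet w A x + t * dirichlet w B x.
Proof.
rewrite /dirichlet !mulr_sumr -big_split; apply: eq_bigr => i _ /=.
rewrite !mulr_sumr -big_split; apply: eq_bigr => j _ /=; rewrite !mxE; ring.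
Qed.

Lemma dirichletE w A x : is_ISM A -> A^T *m w = 0 ->
  dirichlet w A x = - 2 * \sum_(j < n) x j * \sum_(i < n) w i 0 * x i * A i j.
Proof.
move=> [_ Ar] /trmx_mul_eq0P Ac.
have E1 : \sum_(i < n) \sum_(j < n) w i 0 * A i j * x i ^+ 2 = 0.
  rewrite big1 // => i _; transitivity (w i 0 * x i ^+ 2 * \sum_(j < n) A i j).
    by rewrite mulr_sumr; apply: eq_bigr => j _; rewrite mulrAC.
  by rewrite Ar mulr0.
have E2 : \sum_(i < n) \sum_(j < n) w i 0 * A i j * x j ^+ 2 = 0.
  by rewrite exchange_big big1 // => j _ /=; rewrite -mulr_suml Ac mul0r.
have -> : \sum_(j < n) x j * \sum_(i < n) w i 0 * x i * A i j =
    \sum_(i < n) \sum_(j < n) w i 0 * A i j * (x i * x j).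
  rewrite exchange_big; apply: eq_bigr => j _; rewrite mulr_sumr.
  by apply: eq_bigr => i _; ring.
(* The vanishing sums [E1] and [E2] are added back, so that the identity becomes the termwise
   expansion of [(x i - x j) ^+ 2]. *)
rewrite -[RHS]add0r -[X in X + _]addr0 -[X in X + _ + _]E1 -[X in _ + X + _]E2.
rewrite mulr_sumr -!big_split; apply: eq_bigr => i _ /=.
by rewrite mulr_sumr -!big_split; apply: eq_bigr => j _ /=; ring.
Qed.

(* A left null vector [y] of [A] corresponds to [x i = y i / w i]. *)
Lemma simple_dirichletP w A : Sp R n w -> is_ISM A -> A^T *m w = 0 ->
  simple_eigenvalue A 0 <->
  (forall x, dirichlet w A x = 0 -> \sum_(i < n) w i 0 * x i = 0 ->
     forall i, x i = 0).
Proof.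
move=> [w0 w1] IA Aw; have [_ Ar] := IA.
have w_neq0 i : w i 0 != 0 by rewrite gt_eqF.
have A1 : A *m (const_mx 1 : 'cV_n) = 0 by apply/mulmx_const1_eq0P.
have wA : w^T *m A = 0 by rewrite -[A]trmxK -trmx_mul Aw trmx0.
have ww : w^T *m (const_mx 1 : 'cV_n) = 1%:M.
  apply/matrixP => i j; rewrite !ord1 !mxE -[RHS]w1.
  by apply: eq_bigr => k _; rewrite !mxE mulr1.
(* The criterion is used with [u] the vector of ones and [v = w^T]; [v u = 1] because [w] sums to
   one. *)
rewrite /simple_eigenvalue (mup0_char_polyP A1 wA ww);
split=> [H x Dx wx i|H y yA y1].
  pose v : 'rV[R]_n := \row_i (w i 0 * x i).
  have v0 : v = 0.
    apply: H; last first.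
      apply/rowP => k; rewrite !ord1 !mxE -[RHS]wx.
      by apply: eq_bigr => j _; rewrite !mxE mulr1.
    apply/rowP => j; rewrite !mxE.
    have /trmx_mul_eq0P/(_ j) Awj := Aw.
    (* Wherever [A k j] is nonzero, [x k = x j]; so the sum is [x j] times a vanishing column
       sum. *)
    rewrite -[RHS](mulr0 (x j)) -[X in _ = _ * X]Awj mulr_sumr.
    apply: eq_bigr => k _; rewrite mxE.
    have [->|/(dirichlet_eq0 w0 IA Dx) ->] := eqVneq (A k j) 0; ring.
  have /rowP/(_ i) := v0; rewrite !mxE => /eqP.
  by rewrite mulf_eq0 (negPf (w_neq0 i)) => /eqP.
pose x i := y 0 i / w i 0.
have wx i : w i 0 * x i = y 0 i by rewrite /x mulrC divfK.
have x0 : forall i, x i = 0.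
  apply: H.
    rewrite dirichletE // big1 ?mulr0 // => j _.
    have /rowP/(_ j) := yA; rewrite !mxE => yAj.
    by under eq_bigr do rewrite wx; rewrite yAj mulr0.
  have /rowP/(_ 0) := y1; rewrite !mxE => y1s; rewrite -[RHS]y1s.
  by apply: eq_bigr => j _; rewrite wx !mxE mulr1.
by apply/rowP => i; rewrite -wx x0 mulr0 mxE.
Qed.

End Dirichlet.

(** * Nonnegative combinations *)

Lemma ISM_hat_comb (R : realType) (n : nat) (G : digraph n) (w : 'cV[R]_n)
    (A B : 'M[R]_n) (s t : R) : 0 <= s -> 0 <= t ->
  ISM_hat G w A -> ISM_hat G w B -> ISM_hat G w (s *: A + t *: B).
Proof.
move=> s0 t0 [[[A0 Ar] AG] Aw] [[[B0 Br] BG] Bw]; split; last first.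
  by rewrite linearD !linearZ /= mulmxDl -!scalemxAl Aw Bw !scaler0 addr0.
split; [split=> [i j ij|i]|move=> i j ij Gij].
- by rewrite !mxE addr_ge0 // mulr_ge0 ?A0 ?B0.
- under eq_bigr do rewrite !mxE.
  by rewrite big_split /= -!mulr_sumr Ar Br !mulr0 addr0.
- by rewrite !mxE AG ?BG // !mulr0 addr0.
Qed.

(** A zero of the combined form is a zero of the form of [B], since both terms are nonnegative and
    [t > 0]. Only [B] is assumed simple, which is what density requires. *)
Lemma ISM_simple_comb (R : realType) (n : nat) (G : digraph n) (w : 'cV[R]_n)
    (A B : 'M[R]_n) (s t : R) : Sp R n w -> 0 <= s -> 0 < t ->
  ISM_hat G w A -> ISM_simple G w B -> ISM_simple G w (s *: A + t *: B).
Proof.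
move=> hw s0 t0 hA [BG Bs Bw].
have [CG Cw] := ISM_hat_comb s0 (ltW t0) hA (conj BG Bw).
have [w0 _] := hw.
split=> //; apply/(simple_dirichletP hw CG.1 Cw) => x.
rewrite dirichlet_linear => /eqP; rewrite paddr_eq0; last 2 first.
- by rewrite mulr_ge0 // dirichlet_ge0 //; case: hA => -[].
- by rewrite mulr_ge0 ?(ltW t0) // dirichlet_ge0 //; case: BG.
rewrite [X in _ && X]mulf_eq0 (gt_eqF t0) /= => /andP[_ /eqP Bx].
by have /(simple_dirichletP hw BG.1 Bw) := Bs; apply.
Qed.

(** * A positive left null vector and existence of a simple element *)

Lemma ISM_left_kernel (R : realType) (n : nat) (A : 'M[R]_n) :
  (0 < n)%N -> is_ISM A -> exists2 p : 'rV[R]_n, p != 0 & p *m A = 0.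
Proof.
move=> n0 [_ Ar]; have A1 : A *m (const_mx 1 : 'cV_n) = 0.
  exact/mulmx_const1_eq0P.
apply/det0P; apply: contraT; rewrite -unitfE -unitmxE => uA.
have /colP/(_ (Ordinal n0)) : (const_mx 1 : 'cV[R]_n) = 0.
  by rewrite -[LHS](mulKmx uA) A1 mulmx0.
by rewrite !mxE => /eqP; rewrite oner_eq0.
Qed.

(* The triangle inequality makes every coordinate of [|p| A] nonnegative, and
   these coordinates sum to zero because the rows of [A] do. *)
Lemma ISM_left_kernel_norm (R : realType) (n : nat) (A : 'M[R]_n)
    (p : 'rV[R]_n) :
  is_ISM A -> p *m A = 0 -> forall j, \sum_(i < n) `|p 0 i| * A i j = 0.
Proof.
move=> [A0 Ar] pA j.
apply: (psumr_eq0P (P := xpredT)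
  (F := fun j => \sum_(i < n) `|p 0 i| * A i j)) => //.
  move=> {}j _; have /rowP/(_ j) := pA; rewrite !mxE (bigD1 j) //=.
  move/eqP; rewrite addr_eq0 => /eqP pj.
  rewrite (bigD1 j) //= addrC -[X in _ + X]opprK subr_ge0 -mulrN.
  have -> : `|p 0 j| * - A j j = `|p 0 j * A j j|.
    rewrite normrM; congr (_ * _); rewrite ler0_norm //.
    have /eqP := Ar j; rewrite (bigD1 j) //= addr_eq0 => /eqP ->.
    by rewrite oppr_le0 sumr_ge0 // => k kj; rewrite A0 // eq_sym.
  rewrite pj normrN; apply: le_trans (ler_norm_sum _ _ _) _.
  by apply: ler_sum => k kj; rewrite normrM (ger0_norm (A0 _ _ kj)).
rewrite exchange_big big1 // => i _ /=.
by rewrite -mulr_sumr Ar mulr0.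
Qed.

(** Generator sign convention: minus the out-degree on the diagonal, the opposite of the usual graph
    Laplacian. *)
Definition laplacian (R : realType) (n : nat) (G : digraph n) : 'M[R]_n :=
  \matrix_(i, j) ((G i j)%:R - (i == j)%:R * \sum_(k < n) (G i k)%:R).

Lemma laplacian_offdiag (R : realType) (n : nat) (G : digraph n) (i j : 'I_n) :
  i != j -> laplacian R G i j = (G i j)%:R.
Proof. by move=> /negPf ij; rewrite mxE ij mul0r subr0. Qed.

Lemma laplacian_ISM (R : realType) (n : nat) (G : digraph n) :
  is_ISM (laplacian R G).
Proof.
split=> [i j ij|i]; first by rewrite laplacian_offdiag ?ler0n.
under eq_bigr do rewrite mxE.
rewrite big_split sumrN /= -mulr_suml.
have -> : \sum_(j < n) (i == j)%:R = 1 :> R.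
  by rewrite (bigD1 i) //= eqxx big1 ?addr0 // => j /negPf; rewrite eq_sym => ->.
by rewrite mul1r subrr.
Qed.

Lemma edge_neq (n : nat) (G : digraph n) (i j : 'I_n) : G i j -> i != j.
Proof. by apply: contraTneq => ->; rewrite (edge_irreflexive G). Qed.

(** Absolute values of a left null vector form a left null vector. If it vanishes at [b], the
    equation at [b] forces it to vanish at every in-neighbour of [b], hence everywhere by strong
    connectivity. *)
Lemma laplacian_left_kernel_pos (R : realType) (n : nat) (G : digraph n) :
  (0 < n)%N -> strongly_connected G ->
  exists2 p : 'I_n -> R, forall i, 0 < p i &
    forall j, \sum_(i < n) p i * laplacian R G i j = 0.
Proof.
move=> n0 hG; have LI := laplacian_ISM R G.
have [p p0 pL] := ISM_left_kernel n0 LI.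
have pL' := ISM_left_kernel_norm LI pL.
exists (fun i => `|p 0 i|) => // i; rewrite normr_gt0.
apply: contraNneq p0 => pi0; apply/eqP/rowP => k; rewrite mxE.
pose S (k j : 'I_n) := p 0 j = 0 -> p 0 k = 0.
apply: (connect_sub_rel (S := S) _ _ _ (hG k i) pi0)
  => [a //|a b c ab bc /bc /ab //|a b ab pb].
have := pL' b; rewrite (bigD1 b) //= pb normr0 mul0r add0r => s0.
have ab' := edge_neq ab.
have /eqP : `|p 0 a| * laplacian R G a b = 0.
  apply: (psumr_eq0P _ s0) => // c cb.
  by rewrite mulr_ge0 // laplacian_offdiag ?ler0n.
by rewrite laplacian_offdiag // ab mulr1 normr_eq0 => /eqP.
Qed.

Lemma ISM_simple_nonempty (R : realType) (n : nat) (G : digraph n)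
    (w : 'cV[R]_n) :
  strongly_connected G -> Sp R n w -> ISM_simple G w !=set0.
Proof.
move=> hG hw; have [w0 w1] := hw.
have n0 : (0 < n)%N.
  rewrite lt0n; apply/eqP => n0; move: w1; rewrite big1 => [/eqP|i _].
    by rewrite eq_sym oner_eq0.
  by have := ltn_ord i; rewrite [X in (_ < X)%N]n0.
have [p p0 pL] := laplacian_left_kernel_pos R n0 hG.
have [L0 Lr] := laplacian_ISM R G.
pose A : 'M[R]_n := \matrix_(i, j) (p i / w i 0 * laplacian R G i j).
have c0 i : 0 < p i / w i 0 by rewrite divr_gt0.
have AI : is_ISM A.
  split=> [i j ij|i]; first by rewrite mxE mulr_ge0 ?(ltW (c0 i)) ?L0.
  by under eq_bigr do rewrite mxE; rewrite -mulr_sumr Lr mulr0.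
have Aw : A^T *m w = 0.
  apply/trmx_mul_eq0P => j; rewrite -[RHS](pL j); apply: eq_bigr => i _.
  by rewrite mxE mulrA mulrC [w i 0 * _]mulrC divfK ?(gt_eqF (w0 i)) // mulrC.
exists A; split=> //.
  by split=> // i j ij /negPf Gij; rewrite mxE laplacian_offdiag // Gij mulr0.
apply/(simple_dirichletP hw AI Aw) => x Ax wx i.
have xE j : x j = x i.
  apply: (connect_sub_rel (S := fun a b => x a = x b)) (hG j i)
    => [//|a b c -> //|a b ab].
  apply: (dirichlet_eq0 w0 AI Ax); rewrite mxE laplacian_offdiag ?(edge_neq ab) //.
  by rewrite ab mulr1 gt_eqF.
(* The constant value of [x] equals its [w]-weighted mean, which is zero. *)
rewrite -[LHS]mul1r -w1 mulr_suml -[RHS]wx; apply: eq_bigr => k _.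
by rewrite (xE k).
Qed.

(** * Closedness, density and conclusion *)

Lemma continuous_sum (R : realType) (T : topologicalType) (I : Type)
    (r : seq I) (f : I -> T -> R) :
  (forall i, continuous (f i)) -> continuous (fun x => \sum_(i <- r) f i x).
Proof.
move=> fc; elim: r => [|i r IH] x.
  by under eq_fun do rewrite big_nil; exact: cvg_cst.
under eq_fun do rewrite big_cons.
by apply: continuousD; [exact: fc|exact: IH].
Qed.

Lemma ISM_hat_closed (R : realType) (n : nat) (G : digraph n) (w : 'cV[R]_n) :
  closed (ISM_hat G w).
Proof.
move=> A clA.
(* A closed condition on a continuous function of the matrix passes to the closure; each defining
   clause is of this kind. *)
have cl_in (f : 'M[R]_n -> R) (S : set R) : closed S -> continuous f ->
    (forall B, ISM_hat G w B -> S (f B)) -> S (f A).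
  move=> cS /continuous_closedP/(_ _ cS)/closure_id fS HS.
  have : closure (f @^-1` S) A by apply: closureS clA.
  by rewrite -fS.
have coordc := @coord_continuous R n n.
split; [split; [split=> [i j ij|i]|move=> i j ij Gij]|].
- apply: (cl_in (fun B => B i j) [set x | 0 <= x]) => //.
  by move=> B [[[B0 _] _] _]; exact: B0.
- apply: (cl_in (fun B => \sum_(j < n) B i j) [set x | x = 0]).
  + exact: closed_eq.
  + exact: continuous_sum.
  + by move=> B [[[_ Br] _] _]; exact: Br.
- apply: (cl_in (fun B => B i j) [set x | x = 0]) => //.
  by move=> B [[_ BG] _]; exact: BG.
apply/trmx_mul_eq0P => j.
apply: (cl_in (fun B => \sum_(i < n) w i 0 * B i j) [set x | x = 0]).
- exact: closed_eq.
- apply: continuous_sum => i B.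
  by apply: continuousM; [exact: cst_continuous|exact: coordc].
- by move=> B [_ /trmx_mul_eq0P]; apply.
Qed.

Lemma ISM_hat_sub_closure (R : realType) (n : nat) (G : digraph n)
    (w : 'cV[R]_n) :
  strongly_connected G -> Sp R n w ->
  ISM_hat G w `<=` closure (ISM_simple G w).
Proof.
move=> hG hw A hA U UA; have [B hB] := ISM_simple_nonempty hG hw.
have AtB : A + t *: B @[t --> 0^'+] --> A.
  suff : A + t *: B @[t --> 0^'+] --> A + 0 *: B by rewrite scale0r addr0.
  apply: cvgD; first exact: cvg_cst.
  by apply: cvgZr_tmp; apply: cvg_at_right_filter; exact: cvg_id.
(* The right-sided filter at zero keeps [t] positive, so that [A + t *: B] is simple while lying in
   [U]. *)
have [t [t0 Ut]] : exists t : R, 0 < t /\ U (A + t *: B).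
  near (0 : R)^'+ => t; exists t; split; first by near: t; exact: nbhs_right_gt.
  by near: t; exact: AtB.
exists (A + t *: B); split=> //; rewrite -[A]scale1r; exact: ISM_simple_comb.
Unshelve. all: by end_near. Qed.

Theorem proposition14 (R : realType) (n : nat) (G : digraph n) (w : 'cV[R]_n)
    (hG : strongly_connected G) (hw : Sp R n w) :
  [/\ ISM_simple G w !=set0,
      convex_set (ISM_simple G w) &
      closure (ISM_simple G w) = ISM_hat G w].
Proof.
split; first exact: ISM_simple_nonempty.
  apply/convex_setW => A B /set_mem[AG _ Aw] /set_mem hB t t0 t1.
  apply/mem_set; apply: (ISM_simple_comb hw (ltW t0) _ (conj AG Aw) hB).
  by rewrite subr_gt0.
apply/seteqP; split; last exact: ISM_hat_sub_closure.
rewrite [X in _ `<=` X](closure_id _).1; last exact: ISM_hat_closed.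
by apply: closureS => A [].
Qed.
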